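(* Let $(G,+)$ be a nontrivial compact connected metric abelian group with normalized Haar measure $\mu$. Suppose that $\psi:\mathbb N\to\mathbb N$ satisfies $\psi(n)=o(n)$. Then there exists a residual set $\mathcal R^*\subset\mathcal C_0(G)\times G^2$ such that for every $(f,u,x)\in\mathcal R^*$ we have $$\limsup_{n\to\infty}\frac{|S_{n,u}f(x)|}{\psi(n)}=+\infty .$$
   Context: $\mathbb N=\{1,2,3,\dots\}$. Fix a scalar field, $\mathbb R$ or $\mathbb C$ (either is allowed). $\mathcal C_0(G)$ is the space of continuous scalar-valued functions $f$ on $G$ with $\int_G f\,d\mu=0$, equipped with the sup norm. For $u,x\in G$ and $n\ge 1$, $S_{n,u}f(x)=\sum_{k=0}^{n-1}f(x+ku)$. $\mathcal C_0(G)\times G^2$ carries the product topology. A subset of a completely metrizable space is residual if it contains a countable intersection of dense open sets. *)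

(* Defs.v *)
From HB Require Import structures.
From mathcomp Require Import all_boot all_order all_algebra.
From mathcomp Require Import all_classical all_reals all_analysis.
From mathcomp Require Import complex.

Set Implicit Arguments.
Unset Strict Implicit.
Unset Printing Implicit Defensive.

Import Order.TTheory GRing.Theory Num.Theory.
Import numFieldNormedType.Exports.

Local Open Scope classical_set_scope.
Local Open Scope ring_scope.

Record compatible_metric (R : realType) (T : topologicalType)
    (dist : T -> T -> R) : Prop := CompatibleMetric {
  cm_xx : forall x, dist x x = 0 ;
  cm_eq : forall x y, dist x y = 0 -> x = y ;
  cm_sym : forall x y, dist x y = dist y x ;
  cm_triangle : forall y x z, dist x z <= dist x y + dist y z ;
  cm_nbhs : forall x (A : set T),
    nbhs x A <-> exists2 e : R, 0 < e & [set y | dist x y < e] `<=` A }.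

Definition residual (T : topologicalType) (A : set T) : Prop :=
  exists2 U : nat -> set T, (forall n, open (U n) /\ dense (U n))
                          & \bigcap_n U n `<=` A.

(* The library's [measurableType]s are pointed, which [topologicalZmodType]s are
   not, so [g_sigma_algebraType (@open G)] cannot be used directly. *)
Definition borel (G : topologicalZmodType) : Type := G.

Section borel_instance.
Variable G : topologicalZmodType.

Let borelC (A : set G) : <<s @open G >> A -> <<s @open G >> (~` A).
Proof. by rewrite -setTD; exact: sigma_algebraCD. Qed.

HB.instance Definition _ := Choice.on (borel G).
HB.instance Definition _ := isPointed.Build (borel G) (0 : G).
HB.instance Definition _ := @isMeasurable.Build (sigma_display (@open G))
  (borel G) <<s @open G >> (@sigma_algebra0 _ setT (@open G)) borelC
  (@sigma_algebra_bigcup _ setT (@open G)).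

End borel_instance.

(* On a compact metric group every finite Borel measure is regular, so the
   normalized Haar measure is the invariant Borel probability measure. *)
Definition haar (R : realType) (G : topologicalZmodType)
    (mu : probability (borel G) R) : Prop :=
  forall (a : G) (A : set (borel G)), measurable A ->
    mu [set a + x | x in (A : set G)] = mu A.

Variant scalar_kind := RealScalars | ComplexScalars.

Definition scalars (R : realType) (s : scalar_kind) : numFieldType :=
  match s with RealScalars => R | ComplexScalars => R[i] end.

(* The norm of [R[i]] takes its values in [R[i]]; the modulus is real-valued. *)
Definition modulus (R : realType) (s : scalar_kind) : scalars R s -> R :=
  match s with
  | RealScalars => fun z : R => `|z|
  | ComplexScalars => fun z : R[i] => complex.Re `|z|
  end.

Definition scalar_integral (R : realType) (s : scalar_kind)
    (d : measure_display) (T : measurableType d)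
    (mu : {measure set T -> \bar R}) : (T -> scalars R s) -> scalars R s :=
  match s with
  | RealScalars => fun f : T -> R => Rintegral mu setT f
  | ComplexScalars => fun f : T -> R[i] =>
      Complex (Rintegral mu setT (fun x => complex.Re (f x)))
              (Rintegral mu setT (fun x => complex.Im (f x)))
  end.

Section modulus_theory.
Context {R : realType} {s : scalar_kind}.
Implicit Types z w : scalars R s.

Lemma modulus0 : modulus (0 : scalars R s) = 0.
Proof. by case: s => /=; [rewrite normr0|rewrite expr0n/= addr0 sqrtr0]. Qed.

Lemma modulus_ge0 z : 0 <= modulus z.
Proof. by case: s z => //= -[a b]; rewrite sqrtr_ge0. Qed.

Lemma modulus_eq0 z : modulus z = 0 -> z = 0.
Proof.
case: s z => /= [z|[a b]]; first exact: normr0_eq0.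
exact: (@Normc.eq0_normc R (Complex a b)).
Qed.

Lemma modulusN z : modulus (- z) = modulus z.
Proof.
case: s z => z; first exact: (@normrN R R z).
exact: (@normcN R z).
Qed.

Lemma modulusD z w : modulus (z + w) <= modulus z + modulus w.
Proof.
case: s z w => /= z w; first exact: ler_normD.
by case: z w => [a b] [c d]; exact: (@le_normcD R (Complex a b) (Complex c d)).
Qed.

Lemma modulus_lt (r : R) : 0 < r -> exists2 e : scalars R s,
  0 < e & forall z, `|z| < e -> modulus z < r.
Proof.
move=> r0; case: s; first by exists r.
have rC0 : 0 < (r%:C)%C :> R[i] by rewrite ltcR.
have rCP (z : R[i]) : `|z| < (r%:C)%C -> complex.Re `|z| < r.
  by rewrite normc_def ltcR.
by exists (r%:C)%C.
Qed.

End modulus_theory.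

Definition sup_norm (T : Type) (R : realType) (s : scalar_kind)
    (f : T -> scalars R s) : R :=
  sup [set modulus (f x) | x in [set: T]].

(* [cptG] is a parameter so that the sup norm below is finite and the distance
   can be registered as a metric. *)
Record C0 (R : realType) (s : scalar_kind) (G : topologicalZmodType)
    (cptG : compact [set: G]) (mu : probability (borel G) R) := MkC0 {
  C0_fun :> G -> scalars R s ;
  C0_continuous : continuous C0_fun ;
  C0_integral : scalar_integral mu C0_fun = 0 }.

Section C0_metric.
Context {R : realType} {s : scalar_kind} {G : topologicalZmodType}.
Context {cptG : compact [set: G]} {mu : probability (borel G) R}.
Local Notation C0 := (C0 s cptG mu).
Implicit Types f g h : C0.

HB.instance Definition _ := gen_eqMixin C0.
HB.instance Definition _ := gen_choiceMixin C0.

Lemma C0_eqP f g : f =1 g -> f = g.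
Proof.
case: f g => [f cf If] [g cg Ig] /= /funext fg.
by subst g; congr MkC0; exact: Prop_irrelevance.
Qed.

Let dist f g : R := sup_norm (fun x => f x - g x).

Let modulus_le_dist f g x : modulus (f x - g x) <= dist f g.
Proof.
apply: ub_le_sup; last by exists x.
have [e e0 eP] := @modulus_lt R s 1 ltr01.
have bounded_near y : \forall z \near y,
    modulus (f z - g z) <= modulus (f y - g y) + 1.
  have /cvgrPdist_lt /(_ _ e0) : f z - g z @[z --> y] --> f y - g y.
    by apply: cvgB; [exact: C0_continuous|exact: C0_continuous].
  apply: filterS => z /eP /ltW ?.
  rewrite -[f z - g z](subrK (f y - g y)) addrC.
  by rewrite (le_trans (modulusD _ _))// lerD2l -modulusN opprB.
have : compact [set: G] by exact: cptG.
rewrite compact_near_coveringP => /(_ R +oo%R (fun M z => modulus (f z - g z) <= M)).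
case=> [y _|M [_ MP]]; last first.
  exists (M + 1) => _ [z _ <-].
  by apply: (MP (M + 1)) => //; rewrite ltrDl.
exists ([set z | modulus (f z - g z) <= modulus (f y - g y) + 1],
        [set M | modulus (f y - g y) + 1 <= M]) => /=.
  by split; [exact: bounded_near|by apply: nbhs_pinfty_ge; rewrite num_real].
by move=> [z M] [/= zy yM]; exact: le_trans yM.
Qed.

Let dist_le f g (c : R) : (forall x, modulus (f x - g x) <= c) -> dist f g <= c.
Proof.
move=> fgc; apply: ge_sup; first by exists (modulus (f 0 - g 0)), 0.
by move=> _ [x _ <-].
Qed.

Let dist_ff f : dist f f = 0.
Proof.
apply/eqP; rewrite eq_le; apply/andP; split.
  by apply: dist_le => x; rewrite subrr modulus0.
exact: le_trans (modulus_ge0 _) (modulus_le_dist f f 0).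
Qed.

Let dist_eq0 f g : dist f g = 0 -> f = g.
Proof.
move=> fg0; apply: C0_eqP => x; apply/eqP; rewrite -subr_eq0; apply/eqP.
apply: modulus_eq0; apply/eqP; rewrite eq_le modulus_ge0 andbT -fg0.
exact: modulus_le_dist.
Qed.

Let dist_sym f g : dist f g = dist g f.
Proof.
by rewrite /dist /sup_norm; congr (sup (_ @` _)); apply/funext => x;
  rewrite -modulusN opprB.
Qed.

Let dist_triangle g f h : dist f h <= dist f g + dist g h.
Proof.
apply: dist_le => x; rewrite -[f x](subrK (g x)) -addrA.
by rewrite (le_trans (modulusD _ _))// lerD.
Qed.

HB.instance Definition _ :=
  isMetric.Build R C0 dist_ff dist_eq0 dist_sym dist_triangle.

Lemma C0_mdistE f g : mdist f g = sup_norm (fun x => f x - g x).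
Proof. by []. Qed.

End C0_metric.

Definition birkhoff_sum (R : realType) (s : scalar_kind)
    (G : topologicalZmodType) (n : nat) (u : G) (f : G -> scalars R s) (x : G) :
    scalars R s :=
  \sum_(0 <= k < n) f (x + u *+ k).

(* Main.v *)
(* Only f has to be perturbed.  Given (f, u, x) and n, pick a continuous g with
   0 <= g <= 1, g = 1 at the n points x + k u, and small integral; this exists
   because points are Haar-null.  Then h = g - \int g has mean zero, sup norm at
   most 1, and S_{n,u} h (x) >= n / 2.  Since psi n = o(n), for n large one of f
   and f + e h has a Birkhoff sum at x exceeding m psi n, so the open set of
   triples for which this happens at some n > m is dense. *)

Require Import Defs.
From mathcomp Require Import all_boot all_order all_algebra.
From mathcomp Require Import all_classical all_reals all_analysis.
From mathcomp Require Import complex lra.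
Import Order.TTheory GRing.Theory Num.Theory.
Import numFieldNormedType.Exports.
Local Open Scope classical_set_scope.
Local Open Scope ring_scope.

(** * Metrics that induce the topology *)

Section compatible_metric.
Context {R : realType} {T : topologicalType} {dist : T -> T -> R}.
Hypothesis dist_T : compatible_metric dist.

Lemma compatible_metric_continuous p : continuous (dist p).
Proof.
move=> x; apply/cvgrPdist_lt => e e0.
apply/(cm_nbhs dist_T); exists e => // y /= xye.
apply: le_lt_trans xye; rewrite ler_norml lerBrDl lerBlDr.
have := cm_triangle dist_T x p y; have := cm_triangle dist_T y p x.
by rewrite (cm_sym dist_T y x) => ? ?; apply/andP; split; lra.
Qed.

(** The axioms leave positivity implicit; the triangle inequality from [x] to [x] through [y] gives
    [0 <= 2 * dist x y]. *)
Lemma compatible_metric_ge0 x y : 0 <= dist x y.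
Proof.
have := cm_triangle dist_T y x x.
by rewrite (cm_xx dist_T) (cm_sym dist_T y x); lra.
Qed.

Lemma open_compatible_ball p (r : R) : open [set y | dist p y < r].
Proof.
apply: (@open_comp _ _ (dist p) [set t | t < r]); last exact: open_lt.
by move=> x _; exact: compatible_metric_continuous.
Qed.

Lemma compatible_metric_closed_set1 (p : T) : closed [set p].
Proof.
have -> : [set p] = dist p @^-1` [set 0].
  apply/seteqP; split => x /=; first by move=> ->; exact: cm_xx dist_T _.
  by move=> /(cm_eq dist_T).
apply: closed_comp; last exact: closed_eq.
by move=> x _; exact: compatible_metric_continuous.
Qed.

Lemma bigcap_compatible_ball p :
  \bigcap_n [set y | dist p y < n.+1%:R^-1] = [set p].
Proof.
apply/seteqP; split => [y py|_ -> n _ /=]; last first.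
  by rewrite (cm_xx dist_T) invr_gt0.
apply/esym/(cm_eq dist_T)/eqP; rewrite eq_le compatible_metric_ge0 andbT.
rewrite leNgt; apply/negP => d0.
(* For this index [n], [n.+1] exceeds the inverse of [dist p y], so the ball of radius [n.+1%:R^-1]
   already misses [y]. *)
have /(_ (Num.truncn (dist p y)^-1) I) /= := py.
rewrite ltNge => /negP; apply.
rewrite -[leRHS]invrK lef_pV2 ?posrE ?invr_gt0//.
by rewrite ltW// truncnS_gt.
Qed.

End compatible_metric.

(** * Borel sets and integrability of continuous functions *)

Section borel_theory.
Context {R : realType} {G : topologicalZmodType} {mu : probability (borel G) R}.
Implicit Types (h : G -> R).

Lemma open_borel (A : set G) : open A -> measurable (A : set (borel G)).
Proof. by move=> oA; exact: sub_sigma_algebra. Qed.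

Lemma closed_borel (A : set G) : closed A -> measurable (A : set (borel G)).
Proof.
by rewrite -openC => /open_borel/measurableC; rewrite setCK.
Qed.

Hypothesis cptG : compact [set: G].

Lemma continuous_bounded_fun h : continuous h -> [bounded h x | x in [set: G]].
Proof.
move=> ch; have : compact (h @` [set: G]).
  by apply: continuous_compact => //; exact: continuous_subspaceT.
move=> /compact_bounded [M [Mreal hM]]; exists M; split => // N MN x _.
by apply: (hM N MN); exists x.
Qed.

Lemma continuous_integrable h : continuous h ->
  mu.-integrable [set: borel G] (EFin \o h).
Proof.
move=> ch; apply: measurable_bounded_integrable => //.
- exact: le_lt_trans (probability_le1 mu measurableT) (ltry _).
- apply: (measurability _ (measurable_realfun.RGenOpens.measurableE R)).
  move=> _ [_ [a [b ->]] <-].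
  rewrite setTI; apply: open_borel; apply: open_comp => // x _; exact: ch.
- exact: continuous_bounded_fun.
Qed.

End borel_theory.

(** * Points are null for Haar measure *)

Section haar_atomless.
Context {R : realType} {G : topologicalZmodType} {dist : G -> G -> R}.
Context {mu : probability (borel G) R}.
Hypothesis dist_G : compatible_metric dist.

Let vball (p : G) n : set (borel G) := [set y | dist p y < n.+1%:R^-1].

Let measurable_set1 (p : G) : measurable ([set p] : set (borel G)).
Proof.
by apply: closed_borel; exact: (compatible_metric_closed_set1 dist_G).
Qed.

Let measurable_vball (p : G) n : measurable (vball p n).
Proof. by apply: open_borel; exact: (open_compatible_ball dist_G). Qed.

(** Continuity from above of a finite measure. It yields both the absence of atoms and, after that,
    balls of arbitrarily small measure. *)
Lemma measure_compatible_ball_cvg (p : G) :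
  mu ([set y | dist p y < n.+1%:R^-1] : set (borel G)) @[n --> \oo]
    --> mu ([set p] : set (borel G)).
Proof.
rewrite -(bigcap_compatible_ball dist_G p).
apply: (@nonincreasing_cvg_mu _ _ _ mu (vball p)).
- exact: le_lt_trans (probability_le1 mu (measurable_vball _ _)) (ltry _).
- exact: measurable_vball.
- by apply: bigcapT_measurable; exact: measurable_vball.
- move=> m n mn; apply/subsetPset => y /= /lt_le_trans; apply.
  by rewrite lef_pV2 ?posrE// ler_nat.
Qed.

Hypothesis conG : connected [set: G].
Hypothesis ntG : exists g : G, g != 0.
Hypothesis haar_mu : haar mu.

(* If points had mass m > 0, then a small ball around 0 would have mass below
   2m, hence be {0}, and {0} would be clopen. *)
Lemma haar_set1 (p : G) : mu ([set p] : set (borel G)) = 0%E.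
Proof.
have mu1 (q : G) : mu ([set q] : set (borel G)) = mu ([set 0] : set (borel G)).
  rewrite -(haar_mu q _ (measurable_set1 0)); congr (mu _).
  by rewrite image_set1 addr0.
rewrite mu1; apply/eqP/negPn/negP => m0.
set m := mu _ in mu1 m0.
have mfin : m \is a fin_num by exact: fin_num_measure.
have mpos : (0 < m)%E by rewrite lt0e m0 measure_ge0.
have m2 : (m < m + m)%E by rewrite lteDl.
have [n _ /(_ n (leqnn n)) /= ballm] := @measure_compatible_ball_cvg 0 _
  (open_nbhs_nbhs (conj (@open_ereal_lt_ereal R _) m2)).
have ball0 : vball 0 n = [set 0].
  apply/seteqP; split => [y yb|_ ->]; last first.
    by rewrite /vball /= (cm_xx dist_G) invr_gt0.
  apply: contrapT => y0; move: ballm; rewrite ltNge => /negP; apply.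
  rewrite -[X in (_ + X)%E](mu1 y) /m -measureU//; last first.
    by apply/seteqP; split => // z [/= -> ] /esym.
  apply: le_measure; rewrite ?inE//.
  - exact: measurableU.
  - exact: measurable_vball.
  - move=> z [] -> //; rewrite /vball /= (cm_xx dist_G) invr_gt0//.
have [g /eqP g0] := ntG; apply: g0.
suff -> : g = 0 by [].
have : [set 0 : G] = [set: G].
  apply: conG; first by exists 0.
  - exists (vball 0 n); last by rewrite setTI ball0.
    exact: (open_compatible_ball dist_G).
  - exists [set 0]; last by rewrite setTI.
    exact: (compatible_metric_closed_set1 dist_G).
by move=> /seteqP [_ /(_ g I)].
Qed.

End haar_atomless.

(** * Bump functions with small integral, then with mean zero *)

Section bumps.
Context {R : realType} {G : topologicalZmodType} {dist : G -> G -> R}.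
Context {mu : probability (borel G) R}.
Hypothesis dist_G : compatible_metric dist.
Hypothesis cptG : compact [set: G].
Hypothesis mu1 : forall p : G, mu ([set p] : set (borel G)) = 0%E.

Local Notation "\Int h" := (Rintegral mu setT h) (at level 10).

Let bump (e : R) (s : seq G) (h : G -> R) := [/\ continuous h,
  forall x, 0 <= h x <= 1, {in s, forall p, h p = 1} & \Int h <= e].

Lemma bump_point (p : G) (e : R) : 0 < e -> exists h, bump e [:: p] h.
Proof.
move=> e0.
have := @measure_compatible_ball_cvg R G dist mu dist_G p.
rewrite mu1 => /(_ _ (open_nbhs_nbhs (conj (@open_ereal_lt_ereal R e%:E) _))).
case; first by rewrite /= lte_fin.
move=> n _ /(_ n (leqnn n)) /= muB.
set B := (X in mu X) in muB.
have mB : measurable (B : set (borel G)).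
  by apply: open_borel; exact: (open_compatible_ball dist_G).
(* A tent with peak 1 at [p] that vanishes off [B]; it lies below the indicator of [B], whose
   integral is less than [e]. *)
pose h y : R := Num.max 0 (1 - n.+1%:R * dist p y).
have d0 := compatible_metric_ge0 dist_G.
have ch : continuous h.
  move=> y; apply: (@continuous_max R G (fun=> 0)); first exact: cvg_cst.
  apply: cvgB; first exact: cvg_cst.
  by apply: cvgMr; exact: (compatible_metric_continuous dist_G).
have h01 y : 0 <= h y <= 1.
  rewrite /h le_max lexx/= ge_max ler01/= gerBl.
  exact: mulr_ge0.
exists h; split => //.
  move=> q; rewrite inE => /eqP ->.
  by rewrite /h (cm_xx dist_G) mulr0 subr0 max_r.
have intB : mu.-integrable setT (EFin \o (\1_B : borel G -> R)).
  exact: integrable_indic.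
apply: (@le_trans _ _ (\Int (\1_B))).
  apply: le_Rintegral => //; first exact: continuous_integrable.
  move=> y _; have [yB|yB] := pselect (B y).
    by rewrite mem_set//; have /andP[] := h01 y.
  rewrite memNset//  ge_max lexx/= subr_le0.
  rewrite -ler_pdivrMl// mulr1 leNgt; exact/negP.
rewrite /Rintegral integral_indic// setIT -lee_fin fineK; first exact: ltW.
exact: fin_num_measure.
Qed.

(** Induction on the list, giving half of [e] to the head and half to the tail. Entries may repeat,
    as happens along the orbit of an element of finite order. *)
Lemma bump_seq (s : seq G) (e : R) : 0 < e -> exists h, bump e s h.
Proof.
elim: s e => [|p s IHs] e e0.
  exists (fun=> 0); split => //; first by move=> x; exact: cvg_cst.
    by move=> x; rewrite lexx ler01.
  by rewrite Rintegral_cst// mul0r ltW.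
have e20 : 0 < e / 2 by rewrite divr_gt0.
have [g [cg g01 g1 Ig]] := IHs _ e20.
have [h [ch h01 h1 Ih]] := bump_point p _ e20.
(* This is [1 - (1 - g) * (1 - h)]: it stays in [0, 1], equals 1 wherever [g] or [h] does, and is at
   most [g + h], so the integrals add up to at most [e]. *)
pose k x := g x + h x * (1 - g x).
have ck : continuous k.
  move=> x; apply: cvgD; first exact: cg.
  by apply: cvgM; [exact: ch|apply: cvgB; [exact: cvg_cst|exact: cg]].
exists k; split => //.
- move=> x; have /andP[? ?] := g01 x; have /andP[? ?] := h01 x.
  by rewrite /k; apply/andP; split; nra.
- move=> q; rewrite inE => /orP[/eqP ->|qs].
    by rewrite /k h1 ?mem_head// mul1r addrC subrK.
  by rewrite /k g1// subrr mulr0 addr0.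
rewrite [leRHS]splitr; apply: le_trans (lerD Ig Ih).
rewrite -RintegralD//; [|exact: continuous_integrable..].
apply: le_Rintegral => //; [exact: continuous_integrable| |].
  apply: continuous_integrable => // x; apply: cvgD; [exact: cg|exact: ch].
move=> x _; rewrite /k lerD2l.
have /andP[? ?] := g01 x; have /andP[? ?] := h01 x; nra.
Qed.

Lemma mean_zero_bump (s : seq G) : exists h : G -> R,
  [/\ continuous h, forall x, `|h x| <= 1, {in s, forall p, 2^-1 <= h p}
    & \Int h = 0].
Proof.
(* With mean at most 1/2, subtracting it leaves at least 1/2 at the points of [s], however long [s]
   is. *)
have /(bump_seq s _) [g [cg g01 g1 Ig]] : 0 < 2^-1 :> R by rewrite invr_gt0.
have Ig0 : 0 <= \Int g by apply: Rintegral_ge0 => x _; have /andP[] := g01 x.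
exists (fun x => g x - \Int g); split.
- by move=> x; apply: cvgB; [exact: cg|exact: cvg_cst].
- move=> x; have /andP[? ?] := g01 x.
  by rewrite ler_norml; apply/andP; split; lra.
- by move=> p /g1 ->; lra.
- rewrite RintegralB//; last 2 first.
  + exact: continuous_integrable.
  + by apply: continuous_integrable => // x; exact: cvg_cst.
  rewrite Rintegral_cst//.
by rewrite [X in fine X](probability_setT mu) /= mulr1 subrr.
Qed.

End bumps.

(** * Real and complex scalars treated uniformly *)

Definition real_scalar (R : realType) (s : scalar_kind) : R -> scalars R s :=
  match s with
  | RealScalars => fun a => a
  | ComplexScalars => fun a => Complex a 0
  end.
Arguments real_scalar {R} s.

Section scalars_theory.
Context {R : realType} {s : scalar_kind}.
Implicit Types (z w : scalars R s) (a b : R).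

(** Counterpart of [modulus_lt]: together they translate between the scalar-valued norm, which
    defines the topology, and the real-valued modulus. *)
Lemma norm_lt_modulus (e : scalars R s) : 0 < e -> exists2 r : R, 0 < r &
  forall z, modulus z < r -> `|z| < e.
Proof.
case: s e => /= [e e0|]; first by exists e.
(* A positive element of [R[i]] has zero imaginary part, so its real part serves as [r]. *)
move=> [a b]; rewrite ltcE /= => /andP[/eqP -> a0].
by exists a => // -[x y]; rewrite normc_def ltcE /= eqxx.
Qed.

Lemma modulus_real_scalar a : modulus (real_scalar s a) = `|a|.
Proof. by case: s => //=; rewrite expr0n addr0 sqrtr_sqr. Qed.

Lemma real_scalarD a b :
  real_scalar s (a + b) = real_scalar s a + real_scalar s b.
Proof. by case: s => //=; rewrite /GRing.add /= addr0. Qed.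

Lemma real_scalarB a b :
  real_scalar s (a - b) = real_scalar s a - real_scalar s b.
Proof. by apply/esym/eqP; rewrite subr_eq -real_scalarD subrK. Qed.

Lemma real_scalar_sum n (F : nat -> R) :
  real_scalar s (\sum_(0 <= k < n) F k) = \sum_(0 <= k < n) real_scalar s (F k).
Proof.
elim: n => [|n IHn]; first by rewrite !big_nil; case: s.
by rewrite !big_nat_recr//= real_scalarD IHn.
Qed.

Lemma continuous_real_scalar : continuous (real_scalar s : R -> scalars R s).
Proof.
move=> a; apply/cvgrPdist_lt => e /norm_lt_modulus [r r0 re].
near=> b; apply: re; rewrite -real_scalarB modulus_real_scalar.
by near: b; exact: cvgr_dist_lt.
Unshelve. all: by end_near. Qed.

Lemma modulus_triangle_sub z w : `|modulus z - modulus w| <= modulus (z - w).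
Proof.
have := modulusD (z - w) w; have := modulusD (w - z) z.
rewrite !subrK -(modulusN (w - z)) opprB ler_norml => ? ?.
by apply/andP; split; lra.
Qed.

Lemma continuous_modulus : continuous (@modulus R s).
Proof.
move=> z; apply/(@cvgrPdist_lt _ _ _ _ (nbhs_filter z)) => r r0.
have [e e0 er] := @modulus_lt R s r r0.
apply: filterS (nbhsx_ballx z _ e0) => w; rewrite -ball_normE /= => zw.
by apply: le_lt_trans (modulus_triangle_sub _ _) _; exact: er.
Qed.

End scalars_theory.

Lemma continuous_Re (R : realType) :
  continuous (@complex.Re R : scalars R ComplexScalars -> R).
Proof.
move=> z; apply/(@cvgrPdist_lt _ _ _ _ (nbhs_filter z)) => r r0.
have [e e0 er] := @modulus_lt R ComplexScalars r r0.
apply: filterS (nbhsx_ballx z _ e0) => w; rewrite -ball_normE /= => /er.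
apply: le_lt_trans; case: z w => [a b] [c d] /=.
by rewrite -sqrtr_sqr ler_wsqrtr// lerDl sqr_ge0.
Qed.

(** In the complex case the added real function alters only the real part, where additivity of the
    integral applies; the imaginary parts agree pointwise. *)
Lemma scalar_integral_add_real (R : realType) (s : scalar_kind)
    (G : topologicalZmodType) (cptG : compact [set: G])
    (mu : probability (borel G) R) (f : G -> scalars R s) (h : G -> R) :
  continuous f -> continuous h ->
  scalar_integral mu (fun x => f x + real_scalar s (h x)) =
  scalar_integral mu f + real_scalar s (Rintegral mu setT h).
Proof.
case: s f => f cf ch.
  rewrite /scalar_integral /= RintegralD//.
    exact: (continuous_integrable cptG _ cf).
  exact: (continuous_integrable cptG _ ch).
have cRf : continuous (fun x => complex.Re (f x)).
  by move=> x; apply: (continuous_comp (cf x)); exact: continuous_Re.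
rewrite /scalar_integral /= [RHS]/GRing.add /= addr0; congr Complex.
  rewrite -RintegralD//.
  - by apply: eq_Rintegral => x _; case: (f x).
  - exact: (continuous_integrable cptG _ cRf).
  - exact: (continuous_integrable cptG _ ch).
by apply: eq_Rintegral => x _; case: (f x) => a b /=; rewrite addr0.
Qed.

(** * The sup metric and joint continuity of Birkhoff sums *)

Section C0_theory.
Context {R : realType} {s : scalar_kind} {G : topologicalZmodType}.
Context {cptG : compact [set: G]} {mu : probability (borel G) R}.
Local Notation C0 := (C0 s cptG mu).
Implicit Types f g : C0.

Lemma modulus_le_mdist f g x : modulus (f x - g x) <= mdist f g.
Proof.
rewrite C0_mdistE; apply: ub_le_sup; last by exists x.
have /(continuous_bounded_fun cptG) [M [_ hM]] :
    continuous (fun y => modulus (f y - g y)).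
  move=> y; apply: (@continuous_comp _ _ _ (fun y => f y - g y)); last first.
    exact: continuous_modulus.
  by apply: cvgB; exact: C0_continuous.
exists (M + 1) => _ [y _ <-]; apply: le_trans (ler_norm _) _.
by apply: hM => //; rewrite ltrDl.
Qed.

Lemma mdist_le_modulus f g (c : R) :
  (forall x, modulus (f x - g x) <= c) -> mdist f g <= c.
Proof.
move=> fgc; rewrite C0_mdistE; apply: ge_sup.
  by exists (modulus (f 0 - g 0)), 0.
by move=> _ [x _ <-].
Qed.

Lemma C0_add_real f (h : G -> R) :
  continuous h -> Rintegral mu setT h = 0 ->
  exists g : C0, forall x, g x = f x + real_scalar s (h x).
Proof.
move=> ch Ih.
have cg : continuous (fun x => f x + real_scalar s (h x)).
  move=> x; apply: cvgD; first exact: C0_continuous.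
  exact: (continuous_comp (ch x) (@continuous_real_scalar R s _)).
suff Ig : scalar_integral mu (fun x => f x + real_scalar s (h x)) = 0.
  by exists (@MkC0 R s G cptG mu _ cg Ig).
rewrite scalar_integral_add_real//; last exact: C0_continuous.
by rewrite C0_integral Ih add0r; case: s.
Qed.

(** Split [f x - g y] through [f y]: the first difference is small by continuity of [f] at [x], the
    second by the sup distance, uniformly in [y]. *)
Lemma continuous_eval : continuous (fun p : C0 * G => p.1 p.2).
Proof.
move=> [f x]; apply/cvgrPdist_lt => e e0.
have [r r0 re] := norm_lt_modulus e e0.
have r20 : 0 < r / 2 by rewrite divr_gt0.
have [e' e'0 e'P] := @modulus_lt R s (r / 2) r20.
have fx : \forall y \near x, `|f x - f y| < e'.
  have := @C0_continuous _ _ _ _ _ f x _ (nbhsx_ballx (f x) _ e'0).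
  by rewrite -ball_normE.
exists (ball f (r / 2), [set y | `|f x - f y| < e']) => /=.
  by split => //; exact: nbhsx_ballx.
move=> [g y] [/=]; rewrite ballEmdist /= => fg xy.
apply: re; rewrite (splitr r) -[f x](subrK (f y)) -addrA.
apply: le_lt_trans (modulusD _ _) _.
by apply: ltrD; [exact: e'P|exact: le_lt_trans (modulus_le_mdist f g y) fg].
Qed.

Lemma continuous_birkhoff_sum n :
  continuous (fun p : C0 * (G * G) => birkhoff_sum n p.2.1 p.1 p.2.2).
Proof.
(* Each summand is evaluation composed with [(f, u, x) |-> (f, x + u *+ k)], so the orbit points
   must first depend continuously on [(u, x)]. *)
have cstep k : continuous (fun p : C0 * (G * G) => p.2.2 + p.2.1 *+ k).
  elim: k => [|k IHk] p.
    under eq_fun do rewrite mulr0n addr0.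
    exact: (cvg_comp _ _ cvg_snd cvg_snd).
  under eq_fun do rewrite mulrSr addrA.
  apply: (@cvg_comp _ _ _ (fun p : C0 * (G * G) => (p.2.2 + p.2.1 *+ k, p.2.1))
    (fun z => z.1 + z.2) _ _ _ _ (@add_continuous G (_, _))).
  apply: cvg_pair; first exact: IHk.
  exact: (cvg_comp _ _ cvg_snd cvg_fst).
move=> p; rewrite /birkhoff_sum.
elim: n => [|n IHn].
  by under eq_fun do rewrite big_nil; exact: cvg_cst.
under eq_fun do rewrite big_nat_recr//=.
apply: cvgD; first exact: IHn.
apply: (@cvg_comp _ _ _ (fun p : C0 * (G * G) => (p.1, p.2.2 + p.2.1 *+ n))
    (fun z => z.1 z.2) _ _ _ _ (@continuous_eval (p.1, p.2.2 + p.2.1 *+ n))).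
by apply: (@cvg_pair _ _ _ (nbhs p) (nbhs p.1)); [exact: cvg_fst|exact: cstep].
Qed.

End C0_theory.

Lemma limn_esup_eqy (R : realType) (u : nat -> \bar R) :
  (forall m : nat, exists2 n, (m <= n)%N & (m%:R%:E <= u n)%E) ->
  limn_esup u = +oo%E.
Proof.
move=> ubig; apply/eqP; rewrite -leye_eq; apply: le_ereal_inf_tmp.
move=> _ [V [N _ NV] <-]; rewrite leye_eq; apply/eqP/eqyP => A A0.
(* The first entry of the maximum puts [n] in the tail contained in [V]; the second forces [u n]
   above the arbitrary real [A]. *)
have [n] := ubig (maxn N (Num.truncn A).+1); rewrite geq_max => /andP[Nn _] Mu.
apply: le_trans (ereal_sup_ubound _); last by exists n => //; exact: NV.
apply: le_trans Mu; rewrite lee_fin (le_trans (ltW (truncnS_gt A)))//.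
by rewrite ler_nat leq_maxr.
Qed.

(** * Dense open sets of triples with large Birkhoff sums *)

Theorem theorem1p3 (R : realType) (s : scalar_kind) (G : topologicalZmodType)
    (dist : G -> G -> R) (dist_G : compatible_metric dist)
    (cptG : compact [set: G]) (conG : connected [set: G])
    (ntG : exists g : G, g != 0)
    (mu : probability (borel G) R) (haar_mu : haar mu)
    (psi : nat -> nat) (psi_gt0 : forall n, (0 < n)%N -> (0 < psi n)%N)
    (psi_o : (fun n => (psi n)%:R : R) =o_\oo (fun n => n%:R : R)) :
  exists2 Rstar : set (C0 s cptG mu * (G * G)),
    residual Rstar &
    forall (f : C0 s cptG mu) (u x : G), Rstar (f, (u, x)) ->
      limn_esup (fun n => (modulus (birkhoff_sum n u f x) / (psi n)%:R)%:E)
        = +oo%E.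
Proof.
pose S n (p : C0 s cptG mu * (G * G)) : R :=
  modulus (birkhoff_sum n p.2.1 p.1 p.2.2).
(* The condition [m < n] sends [n] to infinity with [m] and makes [n] positive, so that division by
   [psi n] is legitimate; the strict lower bound on [S n] makes [U m] open. *)
pose U m := \bigcup_(n in [set n | (m < n)%N])
  [set p | m%:R * (psi n)%:R < S n p].
exists (\bigcap_m U m); last first.
  move=> f u x Rfux; apply: limn_esup_eqy => m.
  have [n /= mn Sn] := Rfux m I.
  exists n; first exact: ltnW.
  by rewrite lee_fin ler_pdivlMr ?ltr0n ?psi_gt0 ?ltW// (leq_trans _ mn).
exists U => // m; split.
  apply: bigcup_open => n _.
  apply: (@open_comp _ _ (S n) [set t | m%:R * (psi n)%:R < t]).
    move=> p _; apply: (@continuous_comp _ _ _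
      (fun p : C0 s cptG mu * (G * G) => birkhoff_sum n p.2.1 p.1 p.2.2)).
      exact: continuous_birkhoff_sum.
    exact: continuous_modulus.
  exact: open_gt.
move=> O [[f [u x]] Op] oO.
have [[A B] /= [/nbhs_ballP [e /= e0 eA] Bux] AB] :
  nbhs (f, (u, x)) O by exact: open_nbhs_nbhs.
pose d : R := e / 2.
have d0 : 0 < d by rewrite divr_gt0.
(* Chosen so that [psi n <= c * n] gives [m * psi n <= d * n / 8]; dividing by [m.+1] also covers
   [m = 0]. *)
pose c : R := d / 8 / m.+1%:R.
have c0 : 0 < c by rewrite !divr_gt0.
move/eqoP : psi_o => /(_ c c0) [N _ psiN].
pose n := (maxn N m).+1.
have {psiN} psin : (psi n)%:R <= c * n%:R.
  have := psiN n; rewrite /= !ger0_norm//; apply.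
  by rewrite /n ltnW// ltnS leq_maxl.
(* The right side will bound the gap between the two Birkhoff sums from below, so they cannot both
   have modulus at most [m * psi n]. *)
have mpsi : 2 * (m%:R * (psi n)%:R) < d * (n%:R / 2) :> R.
  have le1 : m%:R * (psi n)%:R <= d / 8 * n%:R :> R.
    apply: (@le_trans _ _ (m.+1%:R * (c * n%:R))).
      by apply: ler_pM => //; rewrite ler_nat.
    by rewrite mulrA /c mulrC [m.+1%:R * _]mulrC divfK// mulrC.
  have : 0 < d * n%:R by rewrite mulr_gt0.
  by move: le1; lra.
have mu_pt := @haar_set1 R G dist mu dist_G conG ntG haar_mu.
have [h [ch h1 hs Ih]] := mean_zero_bump dist_G cptG mu_pt
  [seq x + u *+ k | k <- iota 0 n].
have cdh : continuous (fun y => d * h y).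
  by move=> y; apply: cvgM; [exact: cvg_cst|exact: ch].
have [|g gE] := C0_add_real f _ cdh.
  by rewrite RintegralZl// ?Ih ?mulr0//; exact: continuous_integrable.
have Sg : d * (n%:R / 2) <=
    modulus (birkhoff_sum n u g x - birkhoff_sum n u f x).
  (* The contribution of [f] cancels, leaving a real sum of [n] terms, each at least [d / 2]. *)
  have -> : birkhoff_sum n u g x - birkhoff_sum n u f x =
      real_scalar s (\sum_(0 <= k < n) d * h (x + u *+ k)).
    rewrite /birkhoff_sum -sumrB real_scalar_sum.
    by apply: eq_bigr => k _; rewrite gE addrC addKr.
  rewrite modulus_real_scalar (le_trans _ (ler_norm _))// -mulr_sumr.
  have -> : n%:R / 2 = \sum_(0 <= k < n) 2^-1 :> R.
    by rewrite sumr_const_nat subn0 mulr_natl.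
  rewrite ler_pM2l// big_nat [leRHS]big_nat; apply: ler_sum => k /andP[_ kn].
  by apply: hs; apply/mapP; exists k => //; rewrite mem_iota.
have [fbig|fsmall] := ltP (m%:R * (psi n)%:R) (S n (f, (u, x))).
  by exists (f, (u, x)); split => //; exists n => //=; rewrite /n ltnS leq_maxr.
exists (g, (u, x)); split.
  apply: AB; split => /=; last exact: nbhs_singleton.
  apply: eA; rewrite ballEmdist /=.
  (* The perturbation has sup norm at most [d], half the radius [e], so [g] stays in the ball around
     [f]. *)
  apply: (@le_lt_trans _ _ d); last by rewrite /d ltr_pdivrMr// ltr_pMr// ltr1n.
  apply: mdist_le_modulus => y; rewrite gE opprD addrA subrr add0r modulusN.
  by rewrite modulus_real_scalar normrM gtr0_norm// ler_piMr// ltW.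
exists n; first by rewrite /= /n ltnS leq_maxr.
have := modulusD (birkhoff_sum n u g x) (- birkhoff_sum n u f x).
rewrite modulusN; move: Sg mpsi fsmall; rewrite /S /=; lra.
Qed.
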